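(* Every power of a finite cyclic group can be realized as the torsion subgroup of the first homology $H_1$ of some spindle. Namely, for integers $k,r\geqslant 1$ let $X_0=\{1,\dots,k+r\}$ and define $\sigma_{k,r}\colon X_0\to X_0$ by $\sigma_{k,r}(n)=n+1$ if $n<k$ and $\sigma_{k,r}(n)=1$ if $n\geqslant k$. Then the torsion subgroup of $H_1(X_{\sigma_{k,r}})$ is isomorphic to $\mathbb{Z}_k^r$.
   Context: A spindle $(X,\star)$ is a set with a binary operation that is idempotent ($x\star x=x$) and self-distributive ($(x\star y)\star z=(x\star z)\star(y\star z)$). Its one-term distributive chain complex $C(X)$ has $C_n(X)=\mathbb{Z}X^{n+1}$, the free abelian group on sequences $(x_0,\dots,x_n)$ ($n\geqslant 0$), with $\partial_n=\sum_{i=0}^n(-1)^id^i$ where $d^0(x_0,\dots,x_n)=(x_1,\dots,x_n)$ and $d^i(x_0,\dots,x_n)=(x_0\star x_i,\dots,x_{i-1}\star x_i,x_{i+1},\dots,x_n)$ for $i\geqslant1$; the differential vanishes on $C_0(X)$. $H_n(X)$ denotes its homology. Given a function $f\colon X_0\to X_0$ and $X=X_0\sqcup\{b\}$, the $f$-spindle $X_f$ is $X$ with the operation $b\star y=f(y)$ for $y\in X_0$, and $x\star y=y$ in all other cases (so $b\star b=b$). $\mathbb{Z}_k=\mathbb{Z}/k\mathbb{Z}$. *)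

(* Defs.v *)
From HB Require Import structures.
From mathcomp Require Import freeg.
From mathcomp Require Import all_boot all_order all_algebra.
From mathcomp Require Import generic_quotient ring_quotient.
From mathcomp Require Import boolp.

Set Implicit Arguments.
Unset Strict Implicit.
Unset Printing Implicit Defensive.

Import GRing.Theory.
Local Open Scope ring_scope.

HB.mixin Record isSpindle X := {
  star : X -> X -> X;
  starxx : forall x, star x x = x;
  starDl : forall x y z, star (star x y) z = star (star x z) (star y z)
}.

#[short(type="spindleType")]
HB.structure Definition Spindle := {X of isSpindle X & Choice X}.

Notation "x ⋆ y" := (star x y) (at level 40, left associativity).

Notation chain X n := {freeg (n.+1.-tuple X) / int}.

Section Homology.
Variable X : spindleType.

(* The tuple [x] without its [i]-th entry, the entries before it being acted on
   by [tnth x i]; for [i = 0] nothing is acted on. *)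
Definition face n (i : 'I_n.+2) (x : n.+2.-tuple X) : n.+1.-tuple X :=
  [tuple let y := tnth x (lift i j) in if (j < i)%N then y ⋆ tnth x i else y
    | j < n.+1].

Definition boundary n : chain X n -> chain X n.-1 :=
  match n return chain X n -> chain X n.-1 with
  | 0 => fun=> 0
  | n'.+1 => fglift (fun x => \sum_(i < n'.+2) (-1) ^+ i *: << face i x >>)
  end.

Lemma boundary_is_zmod_morphism n : zmod_morphism (@boundary n).
Proof.
case: n => [|n] c d /=; first by rewrite subrr.
exact: lift_is_additive.
Qed.
HB.instance Definition _ n :=
  GRing.isZmodMorphism.Build (chain X n) (chain X n.-1) (@boundary n)
    (@boundary_is_zmod_morphism n).

Definition is_cycle n : {pred chain X n} := fun c => boundary c == 0.

Lemma is_cycle_zmod_closed n : zmod_closed (@is_cycle n).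
Proof.
split=> [|c d]; rewrite !unfold_in ?raddf0 // => /eqP dc /eqP dd.
by rewrite boundary_is_zmod_morphism dc dd subrr.
Qed.
HB.instance Definition _ n :=
  GRing.isZmodClosed.Build (chain X n) (@is_cycle n) (@is_cycle_zmod_closed n).

Record cycle n := Cycle { cycle_chain :> chain X n; _ : cycle_chain \in @is_cycle n }.
HB.instance Definition _ n := [isSub for @cycle_chain n].
HB.instance Definition _ n := [Choice of cycle n by <:].
HB.instance Definition _ n := [SubChoice_isSubZmodule of cycle n by <:].

(* Boundaries are taken among the cycles, so that [homology] below is
   ker/(ker ∩ im); since [boundary] squares to zero this is ker/im. *)
Definition is_boundary n : {pred cycle n} :=
  fun z => `[< exists c : chain X n.+1, boundary c = z :> chain X n >].

Lemma is_boundary_zmod_closed n : zmod_closed (@is_boundary n).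
Proof.
split=> [|z t]; rewrite !unfold_in; first by apply/asboolP; exists 0; rewrite raddf0.
move=> /asboolP[c dc] /asboolP[d dd]; apply/asboolP; exists (c - d).
by rewrite boundary_is_zmod_morphism dc dd.
Qed.
HB.instance Definition _ n :=
  GRing.isZmodClosed.Build (cycle n) (@is_boundary n) (@is_boundary_zmod_closed n).

Definition homology n : zmodType := Quotient.quot (@is_boundary n).

End Homology.

Section Torsion.
Variable A : zmodType.

Definition is_torsion : {pred A} := fun a => `[< exists2 m, (0 < m)%N & a *+ m = 0 >].

Lemma is_torsion_zmod_closed : zmod_closed is_torsion.
Proof.
split=> [|a b]; rewrite !unfold_in; first by apply/asboolP; exists 1%N.
move=> /asboolP[m m0 am] /asboolP[p p0 bp]; apply/asboolP.
exists (m * p)%N; first by rewrite muln_gt0 m0.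
by rewrite mulrnBl mulrnA am mul0rn mulnC mulrnA bp mul0rn subrr.
Qed.
HB.instance Definition _ :=
  GRing.isZmodClosed.Build A is_torsion is_torsion_zmod_closed.

Record torsion := Torsion { torsion_val :> A; _ : torsion_val \in is_torsion }.
HB.instance Definition _ := [isSub for torsion_val].
HB.instance Definition _ := [Choice of torsion by <:].
HB.instance Definition _ := [SubChoice_isSubZmodule of torsion by <:].

End Torsion.

(* Unlike ['Z_k] this is the trivial group for [k = 1]. *)
Definition Zmod (k : nat) : zmodType := @Quotient.quot int (GRing.ZmodClosed.clone int (dvdz k%:Z) _).

Definition zmod_iso (A B : zmodType) : Prop := exists f : {additive A -> B}, bijective f.

Section FSpindle.
Variables (X0 : choiceType) (f : X0 -> X0).

(* [None] is the extra point b. *)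
Definition fspindle_of & X0 -> X0 : Type := option X0.
Definition fspindle := fspindle_of f.

HB.instance Definition _ := Choice.copy fspindle (option X0).

Definition fstar (x y : fspindle) : fspindle :=
  match x, y with
  | None, Some y' => Some (f y')
  | _, _ => y
  end.

Lemma fstarxx x : fstar x x = x.
Proof. by case: x. Qed.

Lemma fstarDl x y z : fstar (fstar x y) z = fstar (fstar x z) (fstar y z).
Proof. by case: x y z => [x|] [y|] [z|]. Qed.

HB.instance Definition _ := isSpindle.Build fspindle fstarxx fstarDl.

End FSpindle.

(* ['I_(k + r)] is {1, ..., k + r} shifted down by one. The value given to
   [insubd] is always less than [k + r], so that its default [n] is not used. *)
Definition sigma (k r : nat) (n : 'I_(k + r)) : 'I_(k + r) :=
  insubd n (if (n.+1 < k)%N then n.+1 else 0%N).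

(* Main.v *)
Require Import Defs.
From HB Require Import structures.
From mathcomp Require Import freeg.
From mathcomp Require Import all_boot all_order all_algebra.
From mathcomp Require Import generic_quotient ring_quotient.
From mathcomp Require Import boolp.

(** Write [b] for the extra point of the spindle, [(x, y)] for the class of that
edge in the cokernel of the boundary from 2-chains to 1-chains, and [f] for a map
of [X0] to itself.  Running through the triangles shows that, besides the free
generators [(b, y)], the cokernel for the [f]-spindle is presented by

- [(b, b) = 0], [(y, y) = 0] and [(y, f y) = 0],
- [(f x, b) = (x, b)],
- [(f x, y) = (x, y) + (f y, y)],

with [x] and [y] in [X0].  So for each fixed [y], applying [f] to the first
vertex adds the constant [c = (f y, y)].

For [f = sigma k r] the graph of [f] is a [k]-cycle with [r] tails of length one
attached to it.  Going once around the cycle gives [k c = 0].  If [y] is on the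
cycle it has a predecessor [p], and then [(p, y) = (p, f p) = 0] and [(y, y) = 0]
force [c = 0], so that every [(x, y)] vanishes.  If [y] is a tail, [f y] is the
base point of the cycle and the remaining relations only say that [(x, y)] is [c]
times the winding number of [x], its position on the cycle counted from 1
([edge_class_winding]).  Thus every class is the sum of a class in a free part
and of multiples of the [r] elements [(base, tail)], each killed by [k]
([edge_class_normal_form]).

To see that these elements have order exactly [k] and are independent, the
winding number modulo [k] along each tail is extended to 1-chains and shown to
vanish on boundaries ([tail_winding_boundary]); the projection to the free part
vanishes on boundaries too ([free_part_boundary]), and hence on torsion.  The
[r] winding numbers are then an isomorphism from the torsion of the first
homology group to the [r]-th power of the integers modulo [k], by the criterion
[torsion_homology_iso]. *)

Set Implicit Arguments.
Unset Strict Implicit.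
Unset Printing Implicit Defensive.

Import GRing.Theory Num.Theory.
Local Open Scope ring_scope.
Local Open Scope quotient_scope.

(** * Homomorphisms on free abelian groups *)

Lemma eq_additive_freeg (K : choiceType) (T : zmodType)
    (g h : {additive {freeg K / int} -> T}) :
  (forall x, g << x >> = h << x >>) -> g =1 h.
Proof.
move=> gh D; rewrite -(freeg_sumE D) !raddf_sum; apply: eq_bigr => x _ /=.
by rewrite -[coeff x D]intz -freegU_mulz !raddfMz gh.
Qed.

Lemma mulrn_freeg_eq0 (K : choiceType) (D : {freeg K / int}) m :
  (0 < m)%N -> D *+ m = 0 -> D = 0.
Proof.
move=> m_gt0 /eqP/freeg_eqP Dm0; apply/eqP/freeg_eqP => x.
have := Dm0 x; rewrite coeffMn coeff0 => /eqP.
by rewrite mulrn_eq0 gtn_eqF //= => /eqP.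
Qed.

(** The library extends functions with values in a module; [zmodule T] is [T] with
its canonical structure of module over the integers. *)
Definition zlift (K : choiceType) (T : zmodType) (g : K -> T) :
  {freeg K / int} -> T := fglift (g : K -> zmodule T).

Lemma zlift_is_zmod_morphism (K : choiceType) (T : zmodType) (g : K -> T) :
  zmod_morphism (zlift g).
Proof. exact: (lift_is_additive (g : K -> zmodule T)). Qed.

HB.instance Definition _ (K : choiceType) (T : zmodType) (g : K -> T) :=
  GRing.isZmodMorphism.Build {freeg K / int} T (zlift g)
    (zlift_is_zmod_morphism g).

Lemma zliftU (K : choiceType) (T : zmodType) (g : K -> T) x :
  zlift g << x >> = g x.
Proof. by rewrite /zlift liftU scale1r. Qed.

Lemma quot_pi_eq0 (A : zmodType) (S : zmodClosed A) (a : A) :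
  (\pi_(Quotient.quot S) a == 0) = (a \in S).
Proof.
by rewrite -[a in RHS]subr0 Quotient.idealrBE -(raddf0 \pi_(Quotient.quot S)).
Qed.

(** * Torsion in homology through the cokernel of the boundary *)

Section Cokernel.
Variables (X : spindleType) (n : nat).

Definition boundary_image : {pred chain X n} :=
  fun c => `[< exists d : chain X n.+1, boundary d = c >].

Lemma boundary_image_zmod_closed : zmod_closed boundary_image.
Proof.
split=> [|c d]; rewrite !unfold_in.
  by apply/asboolP; exists 0; rewrite raddf0.
move=> /asboolP[c' <-] /asboolP[d' <-]; apply/asboolP; exists (c' - d').
by rewrite raddfB.
Qed.
HB.instance Definition _ :=
  GRing.isZmodClosed.Build (chain X n) boundary_image
    boundary_image_zmod_closed.

(** Homology embeds in this group.  Unlike homology it has a class for every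
chain, so that a homologous rewriting of a cycle may pass through chains that
are not cycles. *)
Definition coker : zmodType := Quotient.quot boundary_image.

Lemma coker_boundary (d : chain X n.+1) : \pi_coker (boundary d) = 0.
Proof. by apply/eqP; rewrite quot_pi_eq0; apply/asboolP; exists d. Qed.

Lemma coker_eq0P (c : chain X n) :
  \pi_coker c = 0 <-> exists d : chain X n.+1, boundary d = c.
Proof.
split=> [/eqP|[d <-]]; last exact: coker_boundary.
by rewrite quot_pi_eq0 => /asboolP.
Qed.

End Cokernel.

Section TorsionCriterion.
Variables (X : spindleType) (n : nat) (T : zmodType).
Variable phi : {additive chain X n -> T}.
Hypothesis phi_boundary : forall d : chain X n.+1, phi (boundary d) = 0.
Hypothesis phi_inj : forall (z : chain X n) m, boundary z = 0 -> (0 < m)%N ->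
  \pi_(coker X n) z *+ m = 0 -> phi z = 0 -> \pi_(coker X n) z = 0.
Hypothesis phi_surj : forall t, exists (z : chain X n) m,
  [/\ boundary z = 0, (0 < m)%N, \pi_(coker X n) z *+ m = 0 & phi z = t].

Lemma boundary_cycle (z : Defs.cycle X n) : boundary (val z) = 0.
Proof. by case: z => z /= /eqP. Qed.

Lemma homology_pi_eq0 (z : Defs.cycle X n) :
  \pi_(homology X n) z = 0 <-> \pi_(coker X n) (val z) = 0.
Proof.
split=> [/eqP|/coker_eq0P dz].
  by rewrite quot_pi_eq0 => /asboolP dz; apply/coker_eq0P.
by apply/eqP; rewrite quot_pi_eq0; apply/asboolP.
Qed.

Definition torsion_map (h : torsion (homology X n)) : T :=
  phi (val (repr (val h))).

(** [repr] picks an arbitrary cycle in a homology class; since [phi] vanishes on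
boundaries the choice does not matter. *)
Lemma phi_repr_pi (z : Defs.cycle X n) :
  phi (val (repr (\pi_(homology X n) z))) = phi (val z).
Proof.
apply/eqP; rewrite -subr_eq0 -raddfB.
set t := repr _.
have /homology_pi_eq0/coker_eq0P[d /= dE] : \pi_(homology X n) (t - z) = 0.
  by rewrite raddfB /= reprK subrr.
by rewrite -[X in phi X]dE phi_boundary.
Qed.

Lemma torsion_map_is_zmod_morphism : zmod_morphism torsion_map.
Proof.
move=> g h; rewrite /torsion_map raddfB -raddfB.
case: g h => [g gt] [h ht] /=.
rewrite -[in LHS](reprK g) -[in LHS](reprK h) -2!raddfB.
exact: phi_repr_pi.
Qed.

HB.instance Definition _ := GRing.isZmodMorphism.Build
  (torsion (homology X n)) T torsion_map torsion_map_is_zmod_morphism.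

(** This is how the torsion is computed: [phi] descends to homology, and the
other two hypotheses, on cycles whose class is torsion, make the restriction of
the induced map to the torsion subgroup injective and surjective. *)
Lemma torsion_homology_iso : zmod_iso (torsion (homology X n)) T.
Proof.
have torsion_map_inj : injective torsion_map.
  apply: raddf_inj => -[h htor]; have /asboolP[m m_gt0] := htor.
  rewrite -{1}(reprK h) -raddfMn => /homology_pi_eq0 hm h0.
  apply: val_inj => /=; rewrite -[LHS]reprK; apply/homology_pi_eq0.
  rewrite -[h]/(val (Torsion htor)).
  apply: (phi_inj (boundary_cycle _) m_gt0 _ h0).
  by rewrite -!raddfMn.
have /choice[g gK] : forall t, exists h, torsion_map h = t.
  move=> t; have [z [m [/eqP dz m_gt0 zm phiz]]] := phi_surj t.
  pose h := \pi_(homology X n) (Defs.Cycle dz).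
  have htor : h \in @is_torsion (homology X n).
    apply/asboolP; exists m => //; rewrite -raddfMn.
    by apply/homology_pi_eq0; rewrite !raddfMn.
  by exists (Torsion htor); rewrite /torsion_map phi_repr_pi.
exists torsion_map; exists g => // h; exact/torsion_map_inj/gK.
Qed.
End TorsionCriterion.

(** * Edges and triangles *)

Section LowDegree.
Variable X : spindleType.
Implicit Types x y z : X.

Definition edge x y : chain X 1 := << [tuple x; y] >>.

Definition triangle x y z : chain X 2 := << [tuple x; y; z] >>.

Lemma boundary_edge x y :
  boundary (edge x y) = << [tuple y] >> - << [tuple x ⋆ y] >>.
Proof.
rewrite /edge /= liftU scale1r !big_ord_recr big_ord0 /= add0r expr0 scale1r.
rewrite expr1 scaleN1r; congr (<< _ >> - << _ >>); apply: eq_from_tnth => i;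
  by rewrite !ord1 tnth_mktuple.
Qed.

Lemma boundary_triangle x y z :
  boundary (triangle x y z) = edge y z - edge (x ⋆ y) z + edge (x ⋆ z) (y ⋆ z).
Proof.
rewrite /triangle /= liftU scale1r !big_ord_recr big_ord0 /= add0r expr0.
rewrite scale1r expr1 scaleN1r sqrrN expr1n scale1r.
congr (<< _ >> - << _ >> + << _ >>); apply: eq_from_tnth => -[[|[|//]] i];
  by rewrite tnth_mktuple.
Qed.

Lemma eq_additive_edge (T : zmodType) (g h : {additive chain X 1 -> T}) :
  (forall x y, g (edge x y) = h (edge x y)) -> g =1 h.
Proof.
move=> gh; apply: eq_additive_freeg => t.
case/tupleP: t => x t; case/tupleP: t => y t.
rewrite (tuple0 t); exact: gh.
Qed.

Lemma eq_additive_triangle (T : zmodType) (g h : {additive chain X 2 -> T}) :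
  (forall x y z, g (triangle x y z) = h (triangle x y z)) -> g =1 h.
Proof.
move=> gh; apply: eq_additive_freeg => t.
case/tupleP: t => x t; case/tupleP: t => y t; case/tupleP: t => z t.
rewrite (tuple0 t); exact: gh.
Qed.

Definition edge_lift (T : zmodType) (g : X -> X -> T) : chain X 1 -> T :=
  zlift (fun t => g (tnth t ord0) (tnth t ord_max)).

HB.instance Definition _ (T : zmodType) (g : X -> X -> T) :=
  GRing.Additive.on (edge_lift g).

Lemma edge_liftE (T : zmodType) (g : X -> X -> T) x y :
  edge_lift g (edge x y) = g x y.
Proof. by rewrite /edge_lift zliftU. Qed.

Definition edge_class x y : coker X 1 := \pi_(coker X 1) (edge x y).

Lemma edge_class_triangle x y z :
  edge_class y z + edge_class (x ⋆ z) (y ⋆ z) = edge_class (x ⋆ y) z.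
Proof.
apply/eqP; rewrite -subr_eq0 addrAC -raddfB -raddfD -boundary_triangle.
exact/eqP/coker_boundary.
Qed.

End LowDegree.

(** * The relations in an f-spindle *)

Section FSpindleH1.
Variables (X0 : choiceType) (f : X0 -> X0).
Notation X := (fspindle f).
Notation e := (@edge X).
Implicit Types x y : X0.

(** The eight kinds of triangle, sorted by which vertices are the extra point,
yield no relations other than the five hypotheses. *)
Lemma vanishes_on_boundaries (T : zmodType) (h : {additive chain X 1 -> T}) :
  h (e None None) = 0 ->
  (forall y, h (e (Some y) (Some y)) = 0) ->
  (forall y, h (e (Some y) (Some (f y))) = 0) ->
  (forall x, h (e (Some (f x)) None) = h (e (Some x) None)) ->
  (forall x y, h (e (Some (f x)) (Some y)) =
    h (e (Some x) (Some y)) + h (e (Some (f y)) (Some y))) ->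
  forall d : chain X 2, h (boundary d) = 0.
Proof.
move=> hbb hyy hyf hxb hxy d.
have /= -> := @eq_additive_triangle X T (h \o @boundary X 2) \0 _ d => //.
move=> x y z; rewrite -[LHS]/(h (boundary (triangle x y z))) -[RHS]/(0 : T).
rewrite boundary_triangle raddfD raddfB.
case: x y z => [x|] [y|] [z|]; rewrite /star /= ?subrr ?add0r //.
- by rewrite hxy opprD addrA subrr sub0r addNr.
- by rewrite hxb subrr add0r.
Qed.

Notation edge_class := (@edge_class X).

(** In a triangle with [x ⋆ y = y] two faces cancel and the third is a boundary:
this gives the first three relations.  The other two come from the triangles
whose first vertex is the extra point and whose second vertex is not. *)
Lemma edge_class_bb : edge_class None None = 0.
Proof.
apply: (addrI (edge_class None None)).
by rewrite addr0 (edge_class_triangle (None : X)).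
Qed.

Lemma edge_class_diag y : edge_class (Some y) (Some y) = 0.
Proof.
apply: (addrI (edge_class (Some y) (Some y))).
by rewrite addr0 (edge_class_triangle (Some y : X) (Some y)).
Qed.

Lemma edge_class_step y : edge_class (Some y) (Some (f y)) = 0.
Proof.
apply: (addrI (edge_class None (Some y))).
by rewrite addr0 (edge_class_triangle (Some y : X) None).
Qed.

Lemma edge_class_fb x : edge_class (Some (f x)) None = edge_class (Some x) None.
Proof.
have := edge_class_triangle (None : X) (Some x) None.
by rewrite edge_class_bb addr0.
Qed.

(** For fixed [y], moving the first vertex along [f] adds a constant; this is
the relation that creates torsion. *)
Lemma edge_class_f x y : edge_class (Some (f x)) (Some y) =
  edge_class (Some x) (Some y) + edge_class (Some (f y)) (Some y).
Proof. by have := edge_class_triangle (None : X) (Some x) (Some y). Qed.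

End FSpindleH1.

(** * A cycle with tails *)

Section Sigma.
Variables (k r : nat).
Hypothesis k_gt0 : (0 < k)%N.
Notation X0 := 'I_(k + r).
Notation s := (@sigma k r).
Notation X := (fspindle s).
Notation edge_class := (@edge_class X).
Implicit Types x y : X0.

Definition base : X0 := Ordinal (ltn_addr r k_gt0).

(** The number of [sigma]-steps from a tail to [x]: it is 0 on the tails, and on
the cycle it is the position counted from 1. *)
Definition winding x : nat := if (x < k)%N then x.+1 else 0%N.

Lemma val_sigma x : sigma x = (if (x.+1 < k)%N then x.+1 else 0%N) :> nat.
Proof.
rewrite /sigma val_insubd ifT //.
by case: ifP => [xk|_]; [exact: ltn_addr | rewrite addn_gt0 k_gt0].
Qed.

Lemma sigma_tail y : (k <= y)%N -> sigma y = base.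
Proof. by move=> ky; apply: val_inj; rewrite /= val_sigma ltnNge leqW. Qed.

(** Hence [sigma] increases the winding number by 1 modulo [k]; the carry occurs
at the last point of the cycle. *)
Lemma winding_sigma x : (winding (sigma x) = (winding x).+1) \/
  (winding (sigma x) = 1%N /\ winding x = k).
Proof.
rewrite /winding val_sigma; have [xk|kx] := ltnP x.+1 k.
  by left; rewrite xk (ltnW xk).
rewrite k_gt0; have [xk|_] := ltnP x k; last by left.
by right; split=> //; apply/eqP; rewrite eqn_leq xk kx.
Qed.

Lemma winding_base : winding base = 1%N.
Proof. by rewrite /winding k_gt0. Qed.

Lemma sigma_surj_cycle y : (y < k)%N -> exists x, sigma x = y.
Proof.
(* The predecessor on the cycle, which is the last point when [y] is the base. *)
move=> yk; have pk : ((if y == 0%N :> nat then k.-1 else y.-1) < k + r)%N.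
  apply: ltn_addr; case: ifP => _; first by rewrite prednK.
  exact: leq_ltn_trans (leq_pred y) yk.
exists (Ordinal pk); apply: val_inj; rewrite /= val_sigma /=.
case: eqP => [->|/eqP]; first by rewrite prednK ?ltnn.
by rewrite -lt0n => y0; rewrite prednK // yk.
Qed.

Lemma cycle_ind (P : X0 -> Prop) : P base ->
  (forall x, (x.+1 < k)%N -> P x -> P (sigma x)) ->
  forall x, (x < k)%N -> P x.
Proof.
move=> P0 PS [x xkr] /=; elim: x xkr => [|x IHx] xkr xk.
  by rewrite (_ : Ordinal xkr = base) //; apply: val_inj.
have xkr' : (x < k + r)%N by exact: ltnW.
rewrite (_ : Ordinal xkr = s (Ordinal xkr')).
  by apply: PS => //; exact/IHx/ltnW.
by apply: val_inj; rewrite /= val_sigma xk.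
Qed.

(** The term added on the left lets the tails, whose winding number is 0, enter
the formula on the same footing as the cycle: they map to [base] in one step. *)
Lemma edge_class_winding x y :
  edge_class (Some x) (Some y) + edge_class (Some (s y)) (Some y) =
  edge_class (Some base) (Some y) +
    edge_class (Some (s y)) (Some y) *+ winding x.
Proof.
have [|kx] := ltnP x k; last first.
  by rewrite -edge_class_f sigma_tail // /winding ltnNge kx addr0.
move: x; apply: cycle_ind => [|x xk IHx]; first by rewrite winding_base.
rewrite edge_class_f IHx /winding val_sigma !xk (ltnW xk) -addrA; congr (_ + _).
by rewrite -mulrSr.
Qed.

(** Starting at [base] and going once around the cycle adds the constant [k]
times and comes back to the same class. *)
Lemma edge_class_sigma_mulk y : edge_class (Some (s y)) (Some y) *+ k = 0.
Proof.
(* The last point of the cycle, which [sigma] sends back to [base]. *)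
have lk : (k.-1 < k + r)%N by rewrite ltn_addr // prednK.
have := edge_class_winding (Ordinal lk) y; rewrite /winding /= prednK // leqnn.
rewrite -edge_class_f => E; apply: (addrI (edge_class (Some base) (Some y))).
rewrite addr0 -E (_ : s (Ordinal lk) = base) //.
by apply: val_inj; rewrite /= val_sigma /= prednK ?ltnn.
Qed.

(** A point [y] of the cycle has a predecessor [p], and the step from [p] to [y]
runs from a zero class to a zero class, so the constant for [y] is zero.  Then
the class does not depend on [x], and it is zero at [x = y]. *)
Lemma edge_class_cycle x y : (y < k)%N -> edge_class (Some x) (Some y) = 0.
Proof.
move=> yk; have [p py] := sigma_surj_cycle yk.
have c0 : edge_class (Some (s y)) (Some y) = 0.
  have py0 : edge_class (Some p) (Some y) = 0 by rewrite -py edge_class_step.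
  by have := edge_class_f s p y; rewrite py edge_class_diag py0 add0r.
have cb z : edge_class (Some z) (Some y) = edge_class (Some base) (Some y).
  by have := edge_class_winding z y; rewrite c0 mul0rn !addr0.
by rewrite cb -(cb y) edge_class_diag.
Qed.

(** For a tail [y] the constant is the class at [base], so it cancels from
[edge_class_winding]. *)
Lemma edge_class_tail x y : (k <= y)%N ->
  edge_class (Some x) (Some y) = edge_class (Some base) (Some y) *+ winding x.
Proof.
move=> ky; have := edge_class_winding x y; rewrite sigma_tail // addrC.
exact: addrI.
Qed.

Lemma edge_class_base x :
  edge_class (Some x) None = edge_class (Some base) None.
Proof.
have [xk|kx] := ltnP x k; last by rewrite -edge_class_fb sigma_tail.
by move: x xk; apply: cycle_ind => // x _ <-; rewrite edge_class_fb.
Qed.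

Notation Q := (coker X 1).
Notation tail := (@rshift k r).

(** The projection to the free summand of the cokernel.  Its values are chains
rather than classes, because being torsion-free is immediate for chains. *)
Definition free_part : chain X 1 -> chain X 1 :=
  edge_lift (fun x y : X => match x, y with
    | Some _, None => edge (Some base : X) None
    | None, Some y => edge (None : X) (Some y)
    | _, _ => 0
    end).

HB.instance Definition _ := GRing.Additive.on free_part.

Definition tail_winding (j : 'I_r) : chain X 1 -> int :=
  edge_lift (fun x y : X => match x, y with
    | Some x, Some y => if y == tail j then (winding x)%:Z else 0
    | _, _ => 0
    end).

HB.instance Definition _ j := GRing.Additive.on (tail_winding j).

(** Both sides are additive in [z], so this is the sum of the relations
[edge_class_cycle], [edge_class_tail], [edge_class_base] and [edge_class_bb]. *)
Lemma edge_class_normal_form z :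
  \pi_Q z = \pi_Q (free_part z) +
    \sum_(j < r) edge_class (Some base) (Some (tail j)) *~ tail_winding j z.
Proof.
(* The right-hand side is packed as a homomorphism to compare it on edges. *)
pose N z : Q := \pi_Q (free_part z) +
    \sum_(j < r) edge_class (Some base) (Some (tail j)) *~ tail_winding j z.
have N_add : zmod_morphism N.
  move=> u v; rewrite /N !raddfB opprD addrACA; congr (_ + _).
  by rewrite -sumrB; apply: eq_bigr => j _; rewrite raddfB mulrzBr.
pose Na := GRing.isZmodMorphism.Build _ _ N N_add.
pose N' : {additive chain X 1 -> Q} := HB.pack N Na.
apply: (@eq_additive_edge X Q \pi_Q N') => x y.
rewrite /= /N /free_part edge_liftE -[LHS]/(edge_class x y).
under eq_bigr do rewrite /tail_winding edge_liftE.
case: x y => [x|] [y|].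
- rewrite raddf0 add0r; case: (splitP y) => [i yi|j yj].
    rewrite edge_class_cycle ?yi // big1 // => j _.
    by rewrite ifN // -val_eqE /= yi ltn_eqF // ltn_addr.
  have -> : y = tail j by apply: val_inj.
  rewrite (bigD1 j) //= eqxx big1 ?addr0 => [|i /negPf ij].
    by rewrite edge_class_tail //= leq_addr.
  by rewrite (inj_eq (@rshift_inj _ _)) eq_sym ij.
- by rewrite big1 ?addr0 // edge_class_base.
- by rewrite big1 ?addr0.
- by rewrite big1 ?addr0 // raddf0 edge_class_bb.
Qed.

Lemma free_part_boundary (d : chain X 2) : free_part (boundary d) = 0.
Proof.
apply: vanishes_on_boundaries => *;
  by rewrite /= /free_part !edge_liftE ?addr0.
Qed.

Lemma Zmod_pi_eq0 (n : int) : (\pi_(Zmod k) n == 0) = (k%:Z %| n)%Z.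
Proof. exact: quot_pi_eq0. Qed.

(** The three relations involving [y] hold because [y] has winding number 0 when
it is a tail, because [f y] is never a tail, and because for a tail [y] the
constant [(f y, y)] has winding number 1, which by [winding_sigma] is what [f]
adds to the winding number of [x] modulo [k]. *)
Lemma tail_winding_boundary j (d : chain X 2) :
  \pi_(Zmod k) (tail_winding j (boundary d)) = 0.
Proof.
apply: (@vanishes_on_boundaries _ _ (Zmod k) (\pi_(Zmod k) \o tail_winding j))
  => [|y|y|x|x y]; rewrite /= /tail_winding !edge_liftE ?raddf0 //.
- case: eqP => [->|_]; last by rewrite raddf0.
  by rewrite /winding /= ltnNge leq_addr raddf0.
- rewrite ifN ?raddf0 // -val_eqE /= val_sigma.
  by rewrite ltn_eqF // ltn_addr //; case: ifP.
- case: eqP => [->|_]; last by rewrite raddf0 addr0.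
  rewrite (sigma_tail (y := tail j)) ?leq_addr // winding_base -raddfD.
  case: (winding_sigma x) => [->|[-> ->]].
    by rewrite addrC.
  apply/eqP; rewrite -subr_eq0 -raddfB Zmod_pi_eq0.
  by rewrite opprD addrCA subrr addr0 rpredN; apply: dvdzz.
Qed.

Definition tail_windings (z : chain X 1) : {ffun 'I_r -> Zmod k} :=
  [ffun j => \pi_(Zmod k) (tail_winding j z)].

Lemma tail_windings_is_zmod_morphism : zmod_morphism tail_windings.
Proof. by move=> u v; apply/ffunP => j; rewrite !ffunE !raddfB. Qed.

HB.instance Definition _ := GRing.isZmodMorphism.Build
  (chain X 1) {ffun 'I_r -> Zmod k} tail_windings
  tail_windings_is_zmod_morphism.

Lemma torsion_H1_sigma :
  zmod_iso (torsion (homology X 1)) {ffun 'I_r -> Zmod k}.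
Proof.
apply: (torsion_homology_iso (phi := tail_windings))
  => [d|z m _ m_gt0 zm phiz|t].
- by apply/ffunP => j; rewrite !ffunE tail_winding_boundary.
(* Torsion has no free part, so what remains is a multiple of [k] for each
   tail. *)
- have /coker_eq0P[d /(congr1 free_part)] : \pi_Q (z *+ m) = 0 by rewrite raddfMn.
  rewrite free_part_boundary raddfMn => /esym/(mulrn_freeg_eq0 m_gt0) z0.
  rewrite edge_class_normal_form z0 raddf0 add0r big1 // => j _.
  have /dvdzP[q ->] : (k%:Z %| tail_winding j z)%Z.
    by rewrite -Zmod_pi_eq0; have /ffunP/(_ j) := phiz; rewrite !ffunE => ->.
  rewrite -(sigma_tail (y := tail j)) ?leq_addr //.
  by rewrite mulrC mulrzA -pmulrn edge_class_sigma_mulk mul0rz.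
(* Edges ending in a point of [X0] and starting in one are cycles, and [(base, y)]
   for a tail [y] has winding number 1. *)
pose c j := edge (Some base : X) (Some (tail j)).
exists (\sum_(j < r) c j *~ repr (t j)), k; split=> //.
- rewrite raddf_sum big1 // => j _.
  by rewrite raddfMz [X in X *~ _]boundary_edge subrr mul0rz.
- rewrite raddf_sum -sumrMnl big1 // => j _.
  rewrite raddfMz -[X in X *~ _]/(edge_class (Some base) (Some (tail j))).
  rewrite -(sigma_tail (y := tail j)) ?leq_addr //.
  by rewrite pmulrn mulrzAC -pmulrn edge_class_sigma_mulk mul0rz.
have tail_winding_c i j : tail_winding i (c j) = (j == i)%:Z.
  rewrite /tail_winding edge_liftE (inj_eq (@rshift_inj _ _)) winding_base.
  by case: eqP.
apply/ffunP => i; rewrite ffunE raddf_sum (bigD1 i) //= big1 => [|j /negPf ji].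
  by rewrite addr0 raddfMz [X in X *~ _]tail_winding_c eqxx intz reprK.
by rewrite raddfMz [X in X *~ _]tail_winding_c ji mul0rz.
Qed.

End Sigma.

Local Close Scope ring_scope.

Theorem corollary3p5 (k r : nat) (hk : 1 <= k) (hr : 1 <= r) :
  (exists X : spindleType,
     zmod_iso (torsion (homology X 1)) {ffun 'I_r -> Zmod k}) /\
  zmod_iso (torsion (homology (fspindle (@sigma k r)) 1)) {ffun 'I_r -> Zmod k}.
Proof.
have H1 := torsion_H1_sigma r hk.
by split=> //; exists (fspindle (@sigma k r)).
Qed.
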